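(* The following hold (for $n\geq1$ unless another range is stated): \begin{enumerate} \item $\det(-1;T_0,T_1,\ldots,T_{n-1})=\left\lfloor\frac{2^{n}+6}{14}\right\rfloor$; \item for $n\ge2$, $\det(-1;T_0,T_2,\ldots,T_{2n-2})=\frac{17+\sqrt{17}}{34}\left(\frac32+\frac{\sqrt{17}}{2}\right)^{n-2}+\frac{17-\sqrt{17}}{34}\left(\frac32-\frac{\sqrt{17}}{2}\right)^{n-2}$; \item $\det(1;T_1,T_2,\ldots,T_n)=(-1)^{n-1}\sum_{i=0}^{\lfloor (n-2)/3\rfloor}\binom{n-2-2i}{i}$; \item for $n\ge2$, $\det(-1;T_1,T_2,\ldots,T_n)=\sum_{i=0}^{\lfloor(2n-4)/3\rfloor}\binom{2n-4-2i}{i}$; \item $\det(1;T_1,T_3,\ldots,T_{2n-1})=(-1)^{n-1}\lfloor 4\cdot 3^{n-3}\rfloor$; \item for $n\geq4$, $\det(1;T_3,T_4,\ldots,T_{n+2})=0$; \item $\det(1;T_3,T_5,\ldots,T_{2n+1})=(-2)^{n-1}\sum_{i=0}^{n-1}2^{-i-\lfloor i/2\rfloor}\binom{n-1-i}{\lfloor i/2\rfloor}$; \item for $n\geq2$, $\det(1;T_4,T_5,\ldots,T_{n+3})$ equals $(-1)^n$ if $n\equiv0\pmod 3$, $(-1)^{n+1}$ if $n\equiv1\pmod 3$, and $0$ if $n\equiv 2\pmod 3$; \item for $n\geq3$, $\det(1;T_4,T_6,\ldots,T_{2n+2})=4\cdot(-1)^{n-1}$; \item $\det(1;T_5,T_6,\ldots,T_{n+4})=\sum_{i=0}^{\lfloor(n+1)/2\rfloor}\binom{n+2+i}{n+1-2i}$;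 \item for $n\geq3$, $\det(1;T_5,T_7,\ldots,T_{2n+3})=4$. \end{enumerate}
   Context: The tribonacci numbers are defined by $T_0=T_1=0$, $T_2=1$, $T_n=T_{n-1}+T_{n-2}+T_{n-3}$ for $n\geq3$. For numbers $a_0,a_1,\ldots,a_n$, $\det(a_0;a_1,\ldots,a_n)$ denotes the determinant of the $n\times n$ Toeplitz--Hessenberg matrix whose $(i,j)$ entry is $a_{i-j+1}$ if $i-j+1\ge 0$ and $0$ otherwise (so $a_1$ is on the main diagonal, $a_0$ on the superdiagonal, and all entries above the superdiagonal are $0$). In the listed formulas, the arguments after the semicolon are the indicated sequence with subscripts increasing by a constant step, e.g. $T_0,T_2,\ldots,T_{2n-2}$ means $a_k=T_{2k-2}$ for $k=1,\ldots,n$. *)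

(* Defs.v *)
From mathcomp Require Import all_boot all_order all_algebra.
From mathcomp Require Import reals.

Set Implicit Arguments.
Unset Strict Implicit.
Unset Printing Implicit Defensive.

Import GRing.Theory.
Local Open Scope ring_scope.

Fixpoint tribonacci (n : nat) : nat :=
  match n with
  | 0 | 1 => 0
  | 2 => 1
  | ((m.+1 as m1).+1 as m2).+1 => tribonacci m2 + tribonacci m1 + tribonacci m
  end%N.

(* Only the values [a k] with [1 <= k <= n] are used.  The row and column
   indices start at 0, which leaves the difference [i - j + 1] unchanged. *)
Definition toeplitz_hessenberg (R : comNzRingType) (n : nat) (a0 : R)
    (a : nat -> R) : 'M[R]_n :=
  \matrix_(i < n, j < n)
    if (i.+1 < j)%N then 0
    else if (i.+1 == j)%N then a0
    else a (i.+1 - j)%N.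

(* det(a_0; a_1, ..., a_n). *)
Definition th_det (R : comNzRingType) (n : nat) (a0 : R) (a : nat -> R) : R :=
  \det (toeplitz_hessenberg n a0 a).

(* The sum of [F i] for [0 <= i <= m]; it is empty when [m] is negative. *)
Definition sum_upto (R : comNzRingType) (m : int) (F : nat -> R) : R :=
  match m with
  | Posz k => \sum_(0 <= i < k.+1) F i
  | Negz _ => 0
  end.

(* Main.v *)
(* Expanding a Toeplitz-Hessenberg determinant D_n gives
   D_n = \sum_(1 <= k <= n) (- a_0)^(k-1) a_k D_(n-k), so when (a_k) satisfies a
   linear recurrence of order 3, the D_n with n >= 1 satisfy one too, whose
   coefficients depend on that recurrence and on a_0, a_1, a_2, a_3.  The
   sequences T_(k+s) and T_(2k+s) are of this kind, with characteristic polynomials x^3 - x^2 - x - 1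
   and x^3 - 3x^2 - x - 1.  Each closed form is then identified by checking that
   it satisfies the same recurrence and has the same first three values. *)

Require Import Defs.
From mathcomp Require Import all_boot all_order all_algebra.
From mathcomp Require Import reals.
From mathcomp Require Import zify ring.

Set Implicit Arguments.
Unset Strict Implicit.
Unset Printing Implicit Defensive.

Import GRing.Theory Num.Theory.
Local Open Scope ring_scope.

(** * Row expansion and the order-three recurrence for Toeplitz-Hessenberg determinants *)

Section Recurrence.

Variables (R : comNzRingType) (a0 : R) (a : nat -> R).

(* The arbitrary first column makes the expansion along the first row recursive. *)
Definition th_col_det (n : nat) (b : nat -> R) : R :=
  \det (\matrix_(i < n.+1, j < n.+1)
    if j == 0%N :> nat then b i else toeplitz_hessenberg n.+1 a0 a i j).

Lemma th_det_col n : th_det n.+1 a0 a = th_col_det n (fun k => a k.+1).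
Proof.
congr (\det _); apply/matrixP => i j; rewrite !mxE.
by case: (nat_of_ord j).
Qed.

Lemma th_col_det0 b : th_col_det 0 b = b 0%N.
Proof. by rewrite /th_col_det det_mx11 mxE. Qed.

(** The first row has at most two nonzero entries, [b 0] and [a0]; deleting the second column keeps
    the arbitrary column without its top entry. *)
Lemma th_col_detS n b :
  th_col_det n.+1 b =
    b 0%N * th_det n.+1 a0 a - a0 * th_col_det n (fun k => b k.+1).
Proof.
rewrite {1}/th_col_det (expand_det_row _ ord0) 2!big_ord_recl big1 ?addr0.
  rewrite !mxE /= /cofactor /= !addn0 expr0 mul1r expr1 mulN1r mulrN.
  congr (_ * _ - _ * _); congr (\det _); apply/matrixP => i j; rewrite !mxE //=.
  by case: j => [[|j] ltj] //=; rewrite /bump /= ?add1n.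
by move=> i _; rewrite !mxE /= mul0r.
Qed.

Lemma th_col_det_linear n p q r b1 b2 b3 :
  th_col_det n (fun k => p * b1 k + q * b2 k + r * b3 k) =
    p * th_col_det n b1 + q * th_col_det n b2 + r * th_col_det n b3.
Proof.
elim: n b1 b2 b3 => [|n IHn] b1 b2 b3; first by rewrite !th_col_det0.
by rewrite !th_col_detS IHn; ring.
Qed.

Lemma eq_th_col_det n b1 b2 : b1 =1 b2 -> th_col_det n b1 = th_col_det n b2.
Proof.
by move=> eqb; congr (\det _); apply/matrixP => i j; rewrite !mxE eqb.
Qed.

Lemma th_det1 : th_det 1 a0 a = a 1%N.
Proof. by rewrite th_det_col th_col_det0. Qed.

Lemma th_det2 : th_det 2 a0 a = a 1%N ^+ 2 - a0 * a 2%N.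
Proof. by rewrite th_det_col th_col_detS th_col_det0 th_det1. Qed.

Lemma th_det3 :
  th_det 3 a0 a = a 1%N ^+ 3 - 2 * a0 * a 1%N * a 2%N + a0 ^+ 2 * a 3%N.
Proof.
by rewrite th_det_col !th_col_detS th_col_det0 th_det1 th_det2; ring.
Qed.

(** Three expansions of the determinant of size [n.+4] leave the column [a k.+4], which linearity
    splits into the columns [a k.+3], [a k.+2], [a k.+1]. These are what remains of the sizes
    [n.+3], [n.+2], [n.+1] after two, one and no expansions, so they can be eliminated without
    dividing by [a0]. *)
Lemma th_det_rec p q r :
    (forall k, a k.+4 = p * a k.+3 + q * a k.+2 + r * a k.+1) ->
  forall n, th_det n.+4 a0 a =
    (a 1%N - p * a0) * th_det n.+3 a0 a
    + (q * a0 ^+ 2 - a0 * a 2%N + p * a0 * a 1%N) * th_det n.+2 a0 a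
    + a0 ^+ 2 * (a 3%N - r * a0 - p * a 2%N - q * a 1%N) * th_det n.+1 a0 a.
Proof.
move=> rec_a n.
have D2 := th_det_col n.+1; have D3 := th_det_col n.+2.
have D4 := th_det_col n.+3; rewrite !th_col_detS in D2 D3 D4.
rewrite (eq_th_col_det n rec_a) th_col_det_linear -th_det_col in D4.
by rewrite D4 D3 D2; ring.
Qed.

End Recurrence.

Lemma rec3_unique (R : comNzRingType) (d1 d2 d3 : R) (u v : nat -> R) :
    (forall n, u n.+3 = d1 * u n.+2 + d2 * u n.+1 + d3 * u n) ->
    (forall n, v n.+3 = d1 * v n.+2 + d2 * v n.+1 + d3 * v n) ->
  u 0%N = v 0%N -> u 1%N = v 1%N -> u 2%N = v 2%N -> u =1 v.
Proof.
move=> rec_u rec_v eq0 eq1 eq2 n.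
suff [] : [/\ u n = v n, u n.+1 = v n.+1 & u n.+2 = v n.+2] by [].
elim: n => [|n [IH0 IH1 IH2]] //; split=> //.
by rewrite rec_u rec_v IH0 IH1 IH2.
Qed.

(** * Specialization to tribonacci entries *)

Lemma tribonacciS n :
  tribonacci n.+3 = (tribonacci n.+2 + tribonacci n.+1 + tribonacci n)%N.
Proof. by []. Qed.

(** The squares of the roots of $x^3-x^2-x-1$ are the roots of $x^3-3x^2-x-1$. *)
Lemma tribonacci_bisection n :
  tribonacci n.+4.+2 = (3 * tribonacci n.+4 + tribonacci n.+2 + tribonacci n)%N.
Proof. by rewrite !tribonacciS; lia. Qed.

Section TribonacciDeterminants.

Variables (R : comNzRingType) (a0 : R) (a : nat -> R) (s : nat).

Local Notation D n := (th_det n a0 a).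
Local Notation T n := ((tribonacci n)%:R : R).

(** Since [a] is prescribed at positive indices only, truncated index maps such as [k - 1] are
    admissible. *)
Lemma th_det_tribonacci :
    (forall k, a k.+1 = T (k + s)) ->
  [/\ D 1 = T s, D 2 = T s ^+ 2 - a0 * T s.+1,
      D 3 = T s ^+ 3 - 2 * a0 * T s * T s.+1 + a0 ^+ 2 * T s.+2
    & forall n, D n.+4 = (T s - a0) * D n.+3
      + (a0 ^+ 2 - a0 * T s.+1 + a0 * T s) * D n.+2
      + a0 ^+ 2 * (T s.+2 - a0 - T s.+1 - T s) * D n.+1].
Proof.
move=> aE; rewrite th_det1 th_det2 th_det3 !aE; split=> // n.
rewrite (@th_det_rec _ _ _ 1 1 1) => [|k]; first by rewrite !aE !mul1r.
by rewrite !aE !addSn tribonacciS !natrD !mul1r.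
Qed.

Lemma th_det_tribonacci2 :
    (forall k, a k.+1 = T (k.*2 + s)) ->
  [/\ D 1 = T s, D 2 = T s ^+ 2 - a0 * T s.+2,
      D 3 = T s ^+ 3 - 2 * a0 * T s * T s.+2 + a0 ^+ 2 * T s.+4
    & forall n, D n.+4 = (T s - 3 * a0) * D n.+3
      + (a0 ^+ 2 - a0 * T s.+2 + 3 * a0 * T s) * D n.+2
      + a0 ^+ 2 * (T s.+4 - a0 - 3 * T s.+2 - T s) * D n.+1].
Proof.
move=> aE; rewrite th_det1 th_det2 th_det3 !aE; split=> // n.
rewrite (@th_det_rec _ _ _ 3 1 1) => [|k]; first by rewrite !aE !mul1r.
by rewrite !aE !doubleS !addSn tribonacci_bisection 2!natrD natrM !mul1r.
Qed.

End TribonacciDeterminants.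

(** * Recurrences for the binomial sums *)

Lemma sum_nat_trunc (K L : nat) (F : nat -> nat) :
    (forall i, (minn K L <= i)%N -> F i = 0%N) ->
  (\sum_(0 <= i < K) F i)%N = (\sum_(0 <= i < L) F i)%N.
Proof.
wlog leKL : K L / (K <= L)%N => [wlogF|] F0.
  have [|/ltnW] := leqP K L => le; first exact: wlogF.
  by apply/esym/wlogF => // i; rewrite minnC; apply: F0.
rewrite [RHS](big_cat_nat (n := K)) //= [X in (_ + X)%N]big_nat_cond.
rewrite [X in (_ + X)%N]big1 ?addn0 // => i; rewrite andbT => /andP[leKi _].
by apply: F0; rewrite (minn_idPl leKL).
Qed.

(** Narayana's cows sequence 1, 1, 1, 2, 3, 4, 6, ... The terms with [3 * i > n] vanish, so the
    generous range is harmless. *)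
Definition narayana (n : nat) : nat :=
  (\sum_(0 <= i < n.+1) 'C(n - 2 * i, i))%N.

Lemma narayana_trunc K n : (n < 3 * K)%N ->
  (\sum_(0 <= i < K) 'C(n - 2 * i, i))%N = narayana n.
Proof.
by move=> ltnK; apply: sum_nat_trunc => i le_i; rewrite bin_small //; lia.
Qed.

(** Pascal's rule on the term of index [i.+1] gives the term [i.+1] at [n.+2] plus the term [i] at
    [n]. *)
Lemma narayanaS n : narayana n.+3 = (narayana n.+2 + narayana n)%N.
Proof.
rewrite -(@narayana_trunc n.+2 n.+3); last lia.
rewrite -(@narayana_trunc n.+2 n.+2); last lia.
rewrite /narayana [LHS]big_nat_recl // [in RHS]big_nat_recl // -addnA.
rewrite -big_split /= !bin0; congr (_ + _)%N; apply: eq_big_nat => i _.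
rewrite [RHS]addnC.
(* For [n < 2 * i] the subtractions truncate, but all three binomials vanish. *)
have [le_2i_n|lt_n_2i] := leqP (2 * i) n.
  by rewrite (_ : n.+3 - _ = (n - 2 * i).+1)%N ?binS 1?addnC; [|lia];
     rewrite (_ : n.+2 - _ = n - 2 * i)%N //; lia.
by rewrite !bin_small //; lia.
Qed.

(* Clearing the denominators gives [\sum_i 2 ^ (m - 3i) 'C(m - 2i, i)] for even
   indices and the same sum at [m - 1] for odd ones. *)
Definition half_sum (F : fieldType) (m : nat) : F :=
  2 ^+ m * \sum_(0 <= i < m.+1) 2 ^- (i + i %/ 2) * ('C(m - i, i %/ 2))%:R.

(** Shifting [i] by two raises [i %/ 2] by one, so Pascal's rule applies once the terms [i = 0] and
    [i = 1] are split off. *)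
Lemma half_sumS (F : numFieldType) m :
  half_sum F m.+3 = 2 * half_sum F m.+2 + half_sum F m.
Proof.
have two_step n : half_sum F n.+2 = 2 ^+ n.+2 + 2 ^+ n.+1
    + \sum_(0 <= i < n.+1)
        2 ^+ n.+2 * (2 ^- (i + i %/ 2).+3 * ('C(n - i, (i %/ 2).+1))%:R).
  rewrite /half_sum big_nat_recl // big_nat_recl // addrA mulrDr !bin0 !mulr1.
  rewrite !addn0 expr0 invr1 mulr_sumr; congr (_ + _).
    by rewrite expr1 [2 ^+ n.+2]exprS; field.
  apply: eq_big_nat => i _; rewrite !subSS.
  by rewrite (_ : (i.+2 %/ 2)%N = (i %/ 2).+1) ?(addSn, addnS) //; lia.
(* The sum for [m.+3] has one extra term, [i = m.+1], whose binomial has upper index 0 and positive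
   lower index. *)
rewrite !two_step big_nat_recr //= subnn bin0n !mulr0 addr0.
rewrite 2!mulrDr -!exprS -[RHS]addrA; congr (_ + _).
rewrite /half_sum !mulr_sumr -big_split /=.
apply: eq_big_nat => i; rewrite ltnS => /andP[_ le_im].
rewrite subSn // binS natrD !exprS; field.
by rewrite expf_neq0 // pnatr_eq0.
Qed.

Lemma half_sum_init (F : numFieldType) :
  [/\ half_sum F 0 = 1, half_sum F 1 = 3 & half_sum F 2 = 6].
Proof.
rewrite /half_sum unlock /= -[(0 %/ 2)%N]/0%N -[(1 %/ 2)%N]/0%N.
rewrite -[(2 %/ 2)%N]/1%N /= !subn0 !subnn !bin0 bin0n /= !addn0.
by split; field.
Qed.

(** The binomials $\binom{m+1+i}{m-2i}$ rewritten by symmetry, so that the lower index is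
    independent of [m]. *)
Definition bin3_sum (m : nat) : nat :=
  (\sum_(0 <= i < m.+1) 'C(m.+1 + i, (3 * i).+1))%N.

Lemma bin3_sum_trunc K m : (m < 2 * K)%N ->
  (\sum_(0 <= i < K) 'C(m.+1 + i, (3 * i).+1))%N = bin3_sum m.
Proof.
by move=> ltmK; apply: sum_nat_trunc => i le_i; rewrite bin_small //; lia.
Qed.

(** The third difference of $x \mapsto \binom{x}{y+3}$ is $\binom{x}{y}$, stated without
    subtraction. *)
Lemma third_difference_bin x y :
  ('C(x.+3, y.+3) + 3 * 'C(x.+1, y.+3) =
   3 * 'C(x.+2, y.+3) + 'C(x, y.+3) + 'C(x, y))%N.
Proof. by rewrite !binS; lia. Qed.

(** The third difference in [m] kills the term [i = 0], which is linear in [m], and sends the term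
    [i.+1] to the term [i] at [m.+1]. *)
Lemma bin3_sumS m :
  (bin3_sum m.+3 + 2 * bin3_sum m.+1 = 3 * bin3_sum m.+2 + bin3_sum m)%N.
Proof.
have head n : (n <= m.+3)%N -> bin3_sum n =
    (n.+1 + \sum_(0 <= i < m.+3) 'C(n + i.+2, (3 * i).+4))%N.
  move=> len; rewrite -(@bin3_sum_trunc m.+4); last lia.
  rewrite big_nat_recl // addn0 bin1; congr (_ + _)%N.
  by apply: eq_big_nat => i _; congr 'C(_, _); lia.
have tail : bin3_sum m.+1 =
    (\sum_(0 <= i < m.+3) 'C(m + i.+2, (3 * i).+1))%N.
  rewrite -(@bin3_sum_trunc m.+3); last lia.
  by apply: eq_big_nat => i _; congr 'C(_, _); lia.
have diff : (\sum_(0 <= i < m.+3) 'C(m.+3 + i.+2, (3 * i).+4)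
      + 3 * \sum_(0 <= i < m.+3) 'C(m.+1 + i.+2, (3 * i).+4) =
    3 * \sum_(0 <= i < m.+3) 'C(m.+2 + i.+2, (3 * i).+4)
      + \sum_(0 <= i < m.+3) 'C(m + i.+2, (3 * i).+4)
      + \sum_(0 <= i < m.+3) 'C(m + i.+2, (3 * i).+1))%N.
  rewrite !big_distrr /= -!big_split /=.
  by apply: eq_big_nat => i _; rewrite !addSn third_difference_bin.
have [hd0 hd1] := (head m (ltnW (ltnW (leqnSn _))), head m.+1 (ltnW (leqnSn _))).
have [hd2 hd3] := (head m.+2 (leqnSn _), head m.+3 (leqnn _)).
by lia.
Qed.

(** The squares of the roots of $x^3-x^2-1$ are the roots of $x^3-x^2-2x-1$. *)
Lemma narayana_bisection n :
  narayana n.+4.+2 = (narayana n.+4 + 2 * narayana n.+2 + narayana n)%N.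
Proof. by rewrite !narayanaS; lia. Qed.

Lemma narayana_nat :
  [/\ narayana 0 = 1, narayana 1 = 1, narayana 2 = 1 & narayana 4 = 3]%N.
Proof. by rewrite /narayana unlock. Qed.

(** * Integer parts as Euclidean quotients *)

Lemma floor_divn (R : archiRealFieldType) (m d : nat) : (0 < d)%N ->
  Num.floor (m%:R / d%:R : R) = (m %/ d)%:Z.
Proof.
move=> d_gt0; apply: floor_def.
have d_gt0R : 0 < d%:R :> R by rewrite ltr0n.
rewrite ler_pdivlMr // ltr_pdivrMr // intrD -!pmulrn natr1 -!natrM.
by rewrite ler_nat ltr_nat leq_divM ltn_ceil.
Qed.

(** Modulo 14 the powers $2^n$, $n\geq1$, cycle through 2, 4, 8, so the quotient is $(2^n-c_n)/14$
    with $c_n$ cycling through 2, 4, -6. These sum to 0, and $x^3-x^2-x-2=(x-2)(x^2+x+1)$. *)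
Lemma expn2_div14_rec n :
  ((2 ^ n.+4 + 6) %/ 14 =
   (2 ^ n.+3 + 6) %/ 14 + (2 ^ n.+2 + 6) %/ 14 + 2 * ((2 ^ n.+1 + 6) %/ 14))%N.
Proof.
have : ((2 ^ n.+1) %% 14 \in [:: 2; 4; 8])%N.
  elim: n => [|n] //; rewrite [in X in _ -> X]expnS !inE; lia.
rewrite !(expnS 2 n.+1, expnS 2 n.+2, expnS 2 n.+3) !inE; lia.
Qed.

(** * The eleven evaluations *)

Section Formulas.

Variable R : realType.

Local Notation T n := ((tribonacci n)%:R : R).

Lemma th_det_T0_step1 n : (1 <= n)%N ->
  th_det n (-1) (fun k => T (k - 1)) = (Num.floor ((2 ^+ n + 6) / 14 : R))%:~R.
Proof.
pose a k := T (k - 1); case: n => // n _.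
have [k|D1 D2 D3 recD] := @th_det_tribonacci R (-1) a 0.
  by rewrite /a subn1 addn0.
have -> : (2 ^+ n.+1 + 6) / 14 = (2 ^ n.+1 + 6)%:R / 14%:R :> R.
  by rewrite natrD natrX.
rewrite floor_divn // -pmulrn; pose u k := ((2 ^ k.+1 + 6) %/ 14)%:R : R.
have [u0 u1 u2] : [/\ u 0%N = 0, u 1%N = 0 & u 2%N = 1] by [].
apply: (@rec3_unique R 1 1 2 (fun k => th_det k.+1 (-1) a) u) => [k|k|||].
- by rewrite recD /=; ring.
- by rewrite /u expn2_div14_rec 2!natrD natrM !mul1r.
- by rewrite D1 u0.
- by rewrite D2 u1 /=; ring.
- by rewrite D3 u2 /=; ring.
Qed.

(** The last coefficient $T_4+1-3T_2$ is 0, which leaves order two with characteristic roots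
    $(3\pm\sqrt{17})/2$. *)
Lemma th_det_T0_step2 n : (2 <= n)%N ->
  th_det n (-1) (fun k => T (2 * k - 2))
  = (17 + Num.sqrt 17) / 34 * (3 / 2 + Num.sqrt 17 / 2) ^+ (n - 2)
    + (17 - Num.sqrt 17) / 34 * (3 / 2 - Num.sqrt 17 / 2) ^+ (n - 2).
Proof.
pose a k := T (2 * k - 2); case: n => [|[|n]] // _; rewrite subn2 /=.
have [k|D1 D2 D3 recD] := @th_det_tribonacci2 R (-1) a 0.
  by rewrite /a addn0; congr (tribonacci _)%:R; lia.
set s := Num.sqrt 17; have s2 : s ^+ 2 = 17 by rewrite sqr_sqrtr ?ler0n.
set x := _ + s / 2; set y := _ - s / 2.
have x2 : x ^+ 2 = 3 * x + 2.
  (* Only the added copy of [s ^+ 2 / 4] becomes [17 / 4]; the subtracted one cancels the square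
     inside [x ^+ 2], so [field] closes the goal. *)
  by rewrite -[x ^+ 2](subrK (s ^+ 2 / 4)) {2}s2 /x; field.
have y2 : y ^+ 2 = 3 * y + 2.
  by rewrite -[y ^+ 2](subrK (s ^+ 2 / 4)) {2}s2 /y; field.
pose u k := (17 + s) / 34 * x ^+ k + (17 - s) / 34 * y ^+ k.
have u0 : u 0%N = 1 by rewrite /u; field.
have u1 : u 1%N = 2.
  have -> : u 1%N = (51 + s ^+ 2) / 34 by rewrite /u /x /y; field.
  by rewrite s2; field.
have recu k : u k.+2 = 3 * u k.+1 + 2 * u k.
  have [xE yE] : x ^+ k.+2 = x ^+ 2 * x ^+ k /\ y ^+ k.+2 = y ^+ 2 * y ^+ k.
    by rewrite -!exprD.
  by rewrite /u xE yE x2 y2 !exprS; ring.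
apply: (@rec3_unique R 3 2 0 (fun k => th_det k.+2 (-1) a) u) => [k|k|||].
- by rewrite recD /=; ring.
- by rewrite recu; ring.
- by rewrite D2 u0 /=; ring.
- by rewrite D3 u1 /=; ring.
- by rewrite recD D3 D2 recu u1 u0 /=; ring.
Qed.

Lemma th_det_T1_step1 n : (1 <= n)%N ->
  th_det n 1 (fun k => T k)
  = (-1) ^+ (n - 1)
    * sum_upto ((n%:Z - 2) %/ 3)%Z (fun i => ('C(n - 2 - 2 * i, i))%:R).
Proof.
pose a k := T k; case: n => // n _.
have [k|D1 D2 D3 recD] := @th_det_tribonacci R 1 a 1; first by rewrite addn1.
(* For size 1 the upper bound is $\lfloor -1/3\rfloor=-1$, so the sum is empty, in agreement with
   $T_1=0$. *)
case: n => [|n]; first by rewrite D1 /= mulr0.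
rewrite !subSS !subn0 (_ : n.+2%:Z - 2 = n); last lia.
rewrite divz_nat /= -natr_sum narayana_trunc; last lia.
have [N0 N1 N2 _] := narayana_nat.
pose u k := (-1) ^+ k.+1 * (narayana k)%:R : R.
apply: (@rec3_unique R (-1) 0 (-1) (fun k => th_det k.+2 1 a) u) => [k|k|||].
- by rewrite recD /=; ring.
- by rewrite /u narayanaS natrD !exprS; ring.
- by rewrite D2 /u N0 /=; ring.
- by rewrite D3 /u N1 /=; ring.
- by rewrite recD D3 D2 D1 /u N2 /=; ring.
Qed.

Lemma th_det_T1_step1_neg n : (2 <= n)%N ->
  th_det n (-1) (fun k => T k)
  = \sum_(0 <= i < ((2 * n - 4) %/ 3).+1) ('C(2 * n - 4 - 2 * i, i))%:R.
Proof.
pose a k := T k; case: n => [|[|n]] // _.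
have [k|D1 D2 D3 recD] := @th_det_tribonacci R (-1) a 1.
  by rewrite addn1.
rewrite (_ : 2 * n.+2 - 4 = n.*2)%N; last lia.
rewrite -natr_sum narayana_trunc; last lia.
have [N0 _ N2 N4] := narayana_nat.
pose u k := (narayana k.*2)%:R : R.
apply: (@rec3_unique R 1 2 1 (fun k => th_det k.+2 (-1) a) u) => [k|k|||].
- by rewrite recD /=; ring.
- by rewrite /u !doubleS narayana_bisection 2!natrD natrM !mul1r.
- by rewrite D2 /u N0 /=; ring.
- by rewrite D3 /u N2 /=; ring.
- by rewrite recD D3 D2 D1 /u N4 /=; ring.
Qed.

Lemma th_det_T1_step2 n : (1 <= n)%N ->
  th_det n 1 (fun k => T (2 * k - 1))
  = (-1) ^+ (n - 1) * (Num.floor (4 * 3 ^ (n%:Z - 3) : R))%:~R.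
Proof.
pose a k := T (2 * k - 1).
have [k|D1 D2 D3 recD] := @th_det_tribonacci2 R 1 a 1.
  by congr (tribonacci _)%:R; lia.
(* Sizes 1 and 2 have negative exponents, with floors of 4/9 and 4/3. From size 3 on the argument is
   an integer, and the recurrence is multiplication by -3. *)
case: n => [|[|[|n]]] // _.
- rewrite D1 (_ : 4 * _ = 4%:R / 9%:R); last by rewrite /exprz /=; field.
  by rewrite floor_divn // mulr0.
- rewrite D2 (_ : 4 * _ = 4%:R / 3%:R); last by rewrite /exprz /=; field.
  by rewrite floor_divn // (_ : 4 %/ 3 = 1)%N //=; ring.
rewrite (_ : n.+3%:Z - 3 = n); last lia.
rewrite -exprnP -natrX -natrM -[in RHS](divr1 (_ * _)%:R) (@floor_divn _ _ 1) //.
rewrite divn1 -pmulrn subn1 /=; elim: n => [|n IHn]; first by rewrite D3 /=; ring.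
by rewrite recD IHn !natrM !natrX !exprS /=; ring.
Qed.

(** With $T_3=1$, $T_4=2$, $T_5=4$ all three coefficients of the recurrence vanish. *)
Lemma th_det_T3_step1 n : (4 <= n)%N -> th_det n 1 (fun k => T (k + 2)) = 0.
Proof.
pose a k := T (k + 2); case: n => [|[|[|[|n]]]] // _.
have [k|_ _ _ recD] := @th_det_tribonacci R 1 a 3; first by rewrite /a addSnnS.
by rewrite recD /=; ring.
Qed.

Lemma th_det_T3_step2 n : (1 <= n)%N ->
  th_det n 1 (fun k => T (2 * k + 1))
  = (-2) ^+ (n - 1)
    * \sum_(0 <= i < n) 2 ^- (i + i %/ 2) * ('C(n - 1 - i, i %/ 2))%:R.
Proof.
pose a k := T (2 * k + 1); case: n => // n _; rewrite subn1 /=.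
have [k|D1 D2 D3 recD] := @th_det_tribonacci2 R 1 a 3.
  by congr (tribonacci _)%:R; lia.
rewrite -mulN1r exprMn -mulrA -/(half_sum R n).
have [H0 H1 H2] := half_sum_init R.
pose u k := (-1) ^+ k * half_sum R k.
apply: (@rec3_unique R (-2) 0 (-1) (fun k => th_det k.+1 1 a) u) => [k|k|||].
- by rewrite recD /=; ring.
- by rewrite /u half_sumS !exprS; ring.
- by rewrite D1 /u H0 /=; ring.
- by rewrite D2 /u H1 /=; ring.
- by rewrite D3 /u H2 /=; ring.
Qed.

(** The recurrence has characteristic polynomial $x^2-x+1$, a factor of $x^3+1$, so from size 2 on a
    shift by 3 changes the sign. *)
Lemma th_det_T4_step1 n : (2 <= n)%N ->
  [/\ n = 0 %[mod 3] -> th_det n 1 (fun k => T (k + 3)) = (-1) ^+ n,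
      n = 1 %[mod 3] -> th_det n 1 (fun k => T (k + 3)) = (-1) ^+ (n + 1)
    & n = 2 %[mod 3] -> th_det n 1 (fun k => T (k + 3)) = 0].
Proof.
pose a k := T (k + 3); rewrite -/a.
have [k|D1 D2 D3 recD] := @th_det_tribonacci R 1 a 4.
  by rewrite /a addSnnS.
have period k : th_det k.+4.+1 1 a = - th_det k.+2 1 a.
  by rewrite !recD /=; ring.
have values q : [/\ th_det (3 * q).+2 1 a = 0,
    th_det (3 * q).+3 1 a = (-1) ^+ (3 * q).+3
  & th_det (3 * q).+4 1 a = (-1) ^+ (3 * q).+4.+1].
  elim: q => [|q [IH2 IH3 IH4]].
    by rewrite recD D3 D2 D1 /= !exprS expr0; split; ring.
  rewrite (_ : 3 * q.+1 = (3 * q).+3)%N; last lia.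
  by rewrite !period IH2 IH3 IH4 oppr0 !exprS; split=> //; ring.
move=> n_ge2; have [q nE] : exists q, (n - 2 = 3 * q + (n - 2) %% 3)%N.
  by exists ((n - 2) %/ 3)%N; lia.
have [v2 v3 v4] := values q; split=> n_mod.
- by rewrite (_ : n = (3 * q).+3)%N ?v3 //; lia.
- by rewrite addn1 (_ : n = (3 * q).+4)%N ?v4 //; lia.
- by rewrite (_ : n = (3 * q).+2)%N ?v2 //; lia.
Qed.

(** Only the leading coefficient, -1, survives in the recurrence. *)
Lemma th_det_T4_step2 n : (3 <= n)%N ->
  th_det n 1 (fun k => T (2 * k + 2)) = 4 * (-1) ^+ (n - 1).
Proof.
pose a k := T (2 * k + 2); case: n => [|[|[|n]]] // _; rewrite subn1 /=.
have [k|_ _ D3 recD] := @th_det_tribonacci2 R 1 a 4.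
  by congr (tribonacci _)%:R; lia.
elim: n => [|n IHn]; first by rewrite D3 /=; ring.
by rewrite recD IHn !exprS /=; ring.
Qed.

Lemma th_det_T5_step1 n : (1 <= n)%N ->
  th_det n 1 (fun k => T (k + 4))
  = \sum_(0 <= i < ((n + 1) %/ 2).+1) ('C(n + 2 + i, n + 1 - 2 * i))%:R.
Proof.
pose a k := T (k + 4); case: n => // n _.
have [k|D1 D2 D3 recD] := @th_det_tribonacci R 1 a 5.
  by rewrite /a addSnnS.
rewrite -natr_sum.
have -> : (\sum_(0 <= i < ((n.+1 + 1) %/ 2).+1)
    'C(n.+1 + 2 + i, n.+1 + 1 - 2 * i))%N = bin3_sum n.+2.
  rewrite -(@bin3_sum_trunc ((n.+1 + 1) %/ 2).+1); last lia.
  (* The range ensures that [2 * i] does not exceed the minuend, so the symmetric lower index is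
     exactly [(3 * i).+1]. *)
  apply: eq_big_nat => i /andP[_ lt_i]; rewrite -bin_sub; last lia.
  by congr 'C(_, _); lia.
have [B2 B3 B4] : [/\ bin3_sum 2 = 4, bin3_sum 3 = 9 & bin3_sum 4 = 21]%N.
  by rewrite /bin3_sum unlock.
pose u k := (bin3_sum k.+2)%:R : R.
apply: (@rec3_unique R 3 (-2) 1 (fun k => th_det k.+1 1 a) u) => [k|k|||].
- by rewrite recD /=; ring.
- have /(congr1 (fun m => m%:R : R)) := bin3_sumS k.+2.
  rewrite (natrD _ (bin3_sum _)) (natrD _ (3 * _)) !natrM -/(u k.+3).
  by move => /(canRL (addrK _)) ->; rewrite /u; ring.
- by rewrite D1 /u B2.
- by rewrite D2 /u B3 /=; ring.
- by rewrite D3 /u B4 /=; ring.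
Qed.

(** The recurrence reduces to constancy from size 3 on. *)
Lemma th_det_T5_step2 n : (3 <= n)%N ->
  th_det n 1 (fun k => T (2 * k + 3)) = 4.
Proof.
pose a k := T (2 * k + 3); case: n => [|[|[|n]]] // _.
have [k|_ _ D3 recD] := @th_det_tribonacci2 R 1 a 5.
  by congr (tribonacci _)%:R; lia.
elim: n => [|n IHn]; first by rewrite D3 /=; ring.
by rewrite recD IHn /=; ring.
Qed.

End Formulas.

Theorem theorem3 (R : realType) :
  (* 1 *)
  (forall n : nat, (1 <= n)%N ->
    th_det n (-1) (fun k => (tribonacci (k - 1))%:R : R)
    = (Num.floor ((2 ^+ n + 6) / 14 : R))%:~R) /\
  (* 2 *)
  (forall n : nat, (2 <= n)%N ->
    th_det n (-1) (fun k => (tribonacci (2 * k - 2))%:R : R)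
    = (17 + Num.sqrt 17) / 34 * (3 / 2 + Num.sqrt 17 / 2) ^+ (n - 2)
      + (17 - Num.sqrt 17) / 34 * (3 / 2 - Num.sqrt 17 / 2) ^+ (n - 2)) /\
  (* 3 *)
  (forall n : nat, (1 <= n)%N ->
    th_det n 1 (fun k => (tribonacci k)%:R : R)
    = (-1) ^+ (n - 1)
      * sum_upto ((n%:Z - 2) %/ 3)%Z (fun i => ('C(n - 2 - 2 * i, i))%:R)) /\
  (* 4 *)
  (forall n : nat, (2 <= n)%N ->
    th_det n (-1) (fun k => (tribonacci k)%:R : R)
    = \sum_(0 <= i < ((2 * n - 4) %/ 3).+1) ('C(2 * n - 4 - 2 * i, i))%:R) /\
  (* 5 *)
  (forall n : nat, (1 <= n)%N ->
    th_det n 1 (fun k => (tribonacci (2 * k - 1))%:R : R)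
    = (-1) ^+ (n - 1) * (Num.floor (4 * 3 ^ (n%:Z - 3) : R))%:~R) /\
  (* 6 *)
  (forall n : nat, (4 <= n)%N ->
    th_det n 1 (fun k => (tribonacci (k + 2))%:R : R) = 0) /\
  (* 7 *)
  (forall n : nat, (1 <= n)%N ->
    th_det n 1 (fun k => (tribonacci (2 * k + 1))%:R : R)
    = (-2) ^+ (n - 1)
      * \sum_(0 <= i < n) 2 ^- (i + i %/ 2) * ('C(n - 1 - i, i %/ 2))%:R) /\
  (* 8 *)
  (forall n : nat, (2 <= n)%N ->
    [/\ n = 0 %[mod 3] ->
          th_det n 1 (fun k => (tribonacci (k + 3))%:R : R) = (-1) ^+ n,
        n = 1 %[mod 3] ->
          th_det n 1 (fun k => (tribonacci (k + 3))%:R : R) = (-1) ^+ (n + 1)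
      & n = 2 %[mod 3] ->
          th_det n 1 (fun k => (tribonacci (k + 3))%:R : R) = 0]) /\
  (* 9 *)
  (forall n : nat, (3 <= n)%N ->
    th_det n 1 (fun k => (tribonacci (2 * k + 2))%:R : R)
    = 4 * (-1) ^+ (n - 1)) /\
  (* 10 *)
  (forall n : nat, (1 <= n)%N ->
    th_det n 1 (fun k => (tribonacci (k + 4))%:R : R)
    = \sum_(0 <= i < ((n + 1) %/ 2).+1) ('C(n + 2 + i, n + 1 - 2 * i))%:R) /\
  (* 11 *)
  (forall n : nat, (3 <= n)%N ->
    th_det n 1 (fun k => (tribonacci (2 * k + 3))%:R : R) = 4).
Proof.
split; first exact: th_det_T0_step1.
split; first exact: th_det_T0_step2.
split; first exact: th_det_T1_step1.
split; first exact: th_det_T1_step1_neg.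
split; first exact: th_det_T1_step2.
split; first exact: th_det_T3_step1.
split; first exact: th_det_T3_step2.
split; first exact: th_det_T4_step1.
split; first exact: th_det_T4_step2.
split; first exact: th_det_T5_step1.
exact: th_det_T5_step2.
Qed.
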